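(* Let $p_n$ denote the $n$th prime number. If $\mu$ is an irrationality measure for $6/\pi^2$, then for all sufficiently large $n$ $$p_{n+1} < (p_1 p_2 \cdots p_n)^{2\mu}.$$
   Context: Primes are indexed in increasing order: $p_1 = 2, p_2 = 3, p_3 = 5, \ldots$ Definition (irrationality measure). Let $\xi$ be an irrational number. A positive real number $\mu$ is an irrationality measure for $\xi$ if $$\left| \xi - \frac{a}{b} \right| > \frac{1}{b^\mu}$$ for all integers $a$ and $b$ with $b$ sufficiently large; that is, there exists $B$ such that the inequality holds for all integers $a$ and all integers $b \geq B$. The number $6/\pi^2$ is irrational. *)

(* Defs.v *)
From mathcomp Require Import all_boot all_order all_algebra.
From mathcomp Require Import all_classical all_reals all_analysis.

Set Implicit Arguments.
Unset Strict Implicit.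
Unset Printing Implicit Defensive.

Import Order.TTheory GRing.Theory Num.Theory.

Lemma ex_next_prime (m : nat) : exists p : nat, (m < p)%N && prime p.
Proof. by have [p mp pp] := prime_above m; exists p; rewrite mp pp. Qed.

Definition next_prime (m : nat) : nat := ex_minn (ex_next_prime m).

(* Indexed from 1: nth_prime 1 = 2, nth_prime 2 = 3, nth_prime 3 = 5, and so
   on; nth_prime 0 = 0 is a dummy value. *)
Definition nth_prime (n : nat) : nat := iter n next_prime 0%N.

Local Open Scope ring_scope.

(* The irrationality of xi need not be required separately: it follows from
   the inequality, see irrationality_measure_irrational below. The bound B can
   always be increased, so the values of the division and of the power at
   b <= 0 play no role. *)
Definition irrationality_measure (R : realType) (xi mu : R) : Prop :=
  0 < mu /\
  exists B : int, forall a b : int, B <= b ->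
    `| xi - a%:~R / b%:~R | > 1 / (b%:~R `^ mu).

Lemma irrationality_measure_irrational (R : realType) (xi mu : R) :
  irrationality_measure xi mu -> irrational xi.
Proof.
move=> [_ [B HB]] [q _ qxi].
pose k : int := `|B| + 1.
have k0 : 0 < k by rewrite ltr_wpDl.
have kR : k%:~R != 0 :> R by rewrite intr_eq0 gt_eqF.
have Bk : B <= denq q * k.
  apply: (le_trans (ler_norm B)); apply: (@le_trans _ _ k).
    by rewrite lerDl.
  by rewrite ler_peMl ?(ltW k0)// -gtz0_ge1 denq_gt0.
have := HB (numq q * k) (denq q * k) Bk.
rewrite !intrM invfM mulrACA divff// mulr1 -qxi /ratr subrr normr0.
by rewrite ltNge divr_ge0// powR_ge0.
Qed.

(* Main.v *)
Require Import Defs.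
From mathcomp Require Import all_boot all_order all_algebra.
From mathcomp Require Import all_classical all_reals all_analysis.

Import Order.TTheory GRing.Theory Num.Theory.

Local Open Scope ring_scope.

(** Every irrationality measure exceeds 1, since a = floor (b * xi) already
    gives |xi - a/b| < 1/b. By Euclid's argument p_(n+1) <= P + 1, where
    P = p_1 ... p_n, and P + 1 < P ^ 2 <= P ^ (2 mu) once P >= 2. *)

Lemma irrationality_measure_gt1 (R : realType) (xi mu : R) :
  irrationality_measure xi mu -> 1 < mu.
Proof.
move=> [_ [B HB]]; rewrite ltNge; apply/negP => mu1.
(* Any denominator from [B] on will do; taking it at least 1 makes b ^ mu <= b when mu <= 1. *)
pose b : int := Num.max B 1.
have b1 : 1 <= b%:~R :> R by rewrite ler1z le_max lexx orbT.
have b0 : 0 < b%:~R :> R by apply: lt_le_trans b1.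
have := floor_itv (b%:~R * xi).
set a := Num.floor _ => /andP[fl fu].
have := HB a b; rewrite le_max lexx => /(_ isT).
(* The value 1/b separates the two sides: |xi - a/b| <= 1/b <= 1 / b ^ mu. *)
apply/negP; rewrite -leNgt; apply: (@le_trans _ _ (1 / b%:~R)); last first.
  rewrite !div1r lef_pV2 ?posrE ?powR_gt0//.
  by apply: le_trans (ler_powR b1 mu1) _; rewrite powRr1// ltW.
rewrite -[xi](mulKf (lt0r_neq0 b0)) mulrC -mulrBl normrM.
rewrite [`|_^-1|]gtr0_norm ?invr_gt0// ler_pM2r ?invr_gt0//.
rewrite ger0_norm ?subr_ge0// lerBlDl.
by apply: ltW; rewrite intrD in fu.
Qed.

Lemma prime_next_prime (m : nat) : prime (next_prime m).
Proof. by rewrite /next_prime; case: ex_minnP => p /andP[]. Qed.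

Lemma next_prime_le (m q : nat) :
  (m < q)%N -> prime q -> (next_prime m <= q)%N.
Proof.
by rewrite /next_prime => mq pq; case: ex_minnP => p _; apply; rewrite mq.
Qed.

(** Induction on [n]: no prime lies strictly between consecutive values of [nth_prime], so [q] is
    either covered by the induction hypothesis or equal to the last factor. The base case is
    vacuous, as [nth_prime 0] is 0. *)
Lemma prime_dvd_primorial (n q : nat) : prime q -> (q <= nth_prime n)%N ->
  (q %| \prod_(1 <= i < n.+1) nth_prime i)%N.
Proof.
move=> pq; elim: n => [|n IHn]; first by rewrite leqNgt prime_gt0.
rewrite big_nat_recr//= => qn.
have [/IHn/dvdn_mulr->//|nq] := leqP q (nth_prime n).
suff -> : q = nth_prime n.+1 by rewrite dvdn_mull.
by apply/eqP; rewrite eqn_leq qn next_prime_le.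
Qed.

Lemma primorial_gt0 (n : nat) : (0 < \prod_(1 <= i < n.+1) nth_prime i)%N.
Proof.
by rewrite big_add1 prodn_gt0// => i; rewrite prime_gt0// prime_next_prime.
Qed.

(** The least prime factor of P + 1 exceeds [nth_prime n]: otherwise it would divide both P and P +
    1, hence 1. *)
Lemma nth_primeS_le_primorial (n : nat) :
  (nth_prime n.+1 <= (\prod_(1 <= i < n.+1) nth_prime i).+1)%N.
Proof.
set P := (\prod_(1 <= i < n.+1) _)%N.
have P1 : (1 < P.+1)%N by rewrite ltnS primorial_gt0.
have pq := pdiv_prime P1.
apply: leq_trans (pdiv_leq (ltn0Sn P)); apply: next_prime_le => //.
rewrite ltnNge; apply/negP => /(prime_dvd_primorial _ _ pq) qP.
move: (pdiv_dvd P.+1); rewrite -[X in (_ %| X)%N]addn1 (dvdn_addr _ qP) dvdn1.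
by move=> /eqP q1; rewrite q1 in pq.
Qed.

Lemma primorial_ge2 (n : nat) :
  (0 < n)%N -> (2 <= \prod_(1 <= i < n.+1) nth_prime i)%N.
Proof.
case: n => // n _; rewrite big_nat_recr//=.
apply: leq_trans (prime_gt1 (prime_next_prime (nth_prime n))) _.
by rewrite leq_pmull// primorial_gt0.
Qed.

Theorem theorem1 (R : realType) (mu : R) :
  irrationality_measure (6 / pi ^+ 2) mu ->
  exists N : nat, forall n : nat, (N <= n)%N ->
    ((nth_prime n.+1)%:R : R) <
      ((\prod_(1 <= i < n.+1) nth_prime i)%N%:R) `^ (2 * mu).
Proof.
(* At n = 0 the product is empty and the inequality would read 2 < 1, so the threshold 1 is
   optimal. *)
move=> /irrationality_measure_gt1 mu1; exists 1%N => n n1.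
have := nth_primeS_le_primorial n; have := primorial_ge2 n n1.
set P := (\prod_(1 <= i < n.+1) _)%N => P2 pP.
apply: (@lt_le_trans _ _ (P%:R `^ 2%:R)); last first.
  by rewrite ler_powR ?ler1n ?(ltnW P2)// ler_peMr// ltW.
rewrite powR_mulrn// -natrX ltr_nat (leq_ltn_trans pP)//.
(* The strict bound P + 1 < P ^ 2 unfolds to P + 2 <= P ^ 2; both halves of P + 2 <= P + P <= P * P
   use 2 <= P. *)
apply: (@leq_trans (P + P)%N); first by rewrite -addn2 leq_add2l.
by rewrite addnn -mul2n -mulnn leq_mul2r P2 orbT.
Qed.
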